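(* Let $\alpha,\gamma,\mu>0$ and $0<T<\infty$. The symmetric equilibrium arrival distribution for the two-customer game with index costs and closing time $T$, in which any arrival time $t\le T$ (including $t<0$) is allowed, is defined by the density $$f(t)=\begin{cases}\dfrac{\alpha}{\gamma+\frac{\alpha}{\mu}}, & t\in\left[-\frac{\gamma}{\alpha}\left(1-\dfrac{e^{-\frac{\mu T}{1+\frac{\alpha}{\gamma\mu}}}}{1+\frac{\gamma\mu}{\alpha}}\right)^{-1},0\right),\\[5mm] \dfrac{\mu}{\left(1+\frac{\alpha}{\gamma\mu}\right)\left(1+\frac{\gamma\mu}{\alpha}-e^{-\frac{\mu T}{1+\frac{\alpha}{\gamma\mu}}}\right)}\,e^{-\frac{\mu t}{1+\frac{\alpha}{\gamma\mu}}}, & t\in[0,T],\\[5mm] 0,&\text{otherwise,}\end{cases}$$ and the equilibrium cost of every customer is $\gamma\left(1-\dfrac{e^{-\frac{\mu T}{1+\frac{\alpha}{\gamma\mu}}}}{1+\frac{\gamma\mu}{\alpha}}\right)^{-1}$.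
   Context: Model. There are two customers, each choosing (possibly at random, independently) an arrival time $t\le T$. A single server starts operating at time $0$ and serves First Come First Served; service times are i.i.d. exponential with rate $\mu$. No arrivals are possible after the closing time $T$, but all who arrived by time $T$ are served, even after $T$. Customers arriving at exactly the same time are admitted in uniformly random order. Each customer pays $\alpha$ per unit of time from arrival until admission into service, and $\gamma$ if the other customer is ahead of him in the arrival order. When the other customer arrives according to a cdf $F$, the expected cost of arriving at $t$ is $$c_F(t)=-\alpha t\,\mathbf{1}_{\{t<0\}}+\frac{\alpha}{\mu}\mathbb{E}Q_F(t)+\gamma\,\mathbb{E}A_F(t),$$ where $A_F(t)\in\{0,1\}$ indicates whether the other customer has arrived up to time $t$ and $Q_F(t)\in\{0,1\}$ whether he is present in the system at time $t$; if $F$ has an atom at $t$, a simultaneous arrival counts only if placed ahead by the random tie-breaking. A symmetric equilibrium arrival distribution is a cdf $F$ for which there is a constant $c_e$ (the equilibrium cost) such that $c_F(t)=c_e$ for all $t$ in the support of $F$ and $c_F(t)\ge c_e$ for every admissible $t$. Only distributions $F$ whose support is, on any finite interval, a finite union of closed intervals and points are considered. *)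

(* Defs.v *)
From HB Require Import structures.
From mathcomp Require Import all_boot all_order all_algebra.
From mathcomp Require Import all_classical all_reals all_analysis.

Set Implicit Arguments.
Unset Strict Implicit.
Unset Printing Implicit Defensive.

Import Order.TTheory GRing.Theory Num.Theory.
Import numFieldNormedType.Exports.

Local Open Scope classical_set_scope.
Local Open Scope ring_scope.

(* A cdf is an element of [cumulativeBounded 0 1]: a nondecreasing
   right-continuous function with limits 0 and 1 at -oo and +oo. *)
Notation cdf_on R := (cumulativeBounded (0 : R) (1 : R)).

Section Model.
Context {R : realType}.

Definition arrival_law (F : cdf_on R) : probability (measurableTypeR R) R :=
  lebesgue_stieltjes_measure F.

(* The probability structure of [exponential_prob mu] depends on a proof that
   the rate is positive, which unification alone cannot supply. *)
Definition service_law (mu : R) (mu_gt0 : 0 < mu) :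
  probability (measurableTypeR R) R.
Proof.
refine (exponential_prob mu : probability (measurableTypeR R) R).
exact: mu_gt0.
Defined.

(* A sample point (s, x, b) consists of the other customer's arrival time s,
   his service time x, and the fair coin b that breaks a tie: b = true when he
   is placed ahead. The three coordinates are independent. *)
Definition other_law (mu : R) (mu_gt0 : 0 < mu) (F : cdf_on R) :
    probability (measurableTypeR R * measurableTypeR R * bool)%type R :=
  ((arrival_law F \x service_law mu_gt0) \x bernoulli_prob (2^-1 : R))%E.

Definition other_ahead (t : R) (w : R * R * bool) : bool :=
  (w.1.1 < t) || ((w.1.1 == t) && w.2).

(* An other customer who is ahead finds the server free, so that his service
   occupies the time interval from Num.max s 0 to Num.max s 0 + x. *)
Definition other_present (t : R) (w : R * R * bool) : bool :=
  other_ahead t w && (t < Num.max w.1.1 0 + w.1.2).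

(* The indicators A_F(t) and Q_F(t), as functions of the sample point *)
Definition ahead_indicator (t : R) (w : R * R * bool) : R := (other_ahead t w)%:R.
Definition present_indicator (t : R) (w : R * R * bool) : R := (other_present t w)%:R.

Definition expected_cost (alpha gamma mu : R) (mu_gt0 : 0 < mu)
    (F : cdf_on R) (t : R) : \bar R :=
  ((- alpha * t * (t < 0)%R%:R)%:E
   + (alpha / mu)%:E * 'E_(other_law mu_gt0 F)[present_indicator t]
   + gamma%:E * 'E_(other_law mu_gt0 F)[ahead_indicator t])%E.

Definition cdf_support (F : cdf_on R) : set R :=
  [set t | forall e : R, 0 < e ->
    (0%:E < arrival_law F [set` `](t - e)%R, (t + e)%R[%R])%E].

(* A pair p stands for the closed interval [p.1, p.2], which is a point when
   p.1 = p.2. *)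
Definition regular_support (F : cdf_on R) : Prop :=
  forall a b : R, exists s : seq (R * R),
    cdf_support F `&` `[a, b] = \bigcup_(p in [set` s]) `[p.1, p.2]%classic.

(* F ranges over the admissible cdfs: arrivals after the closing time T are
   impossible (F T = 1) and the support is regular. *)
Definition symmetric_equilibrium (alpha gamma mu T : R) (mu_gt0 : 0 < mu)
    (F : cdf_on R) (c_e : R) : Prop :=
  [/\ F T = 1,
      regular_support F,
      forall t, cdf_support F t ->
        expected_cost alpha gamma mu_gt0 F t = c_e%:E
    & forall t, t <= T -> (c_e%:E <= expected_cost alpha gamma mu_gt0 F t)%E].

Definition has_density (F : cdf_on R) (f : R -> R) : Prop :=
  forall t, (F t)%:E = (\int[lebesgue_measure]_(x in `]-oo, t]) (f x)%:E)%E.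

Definition equilibrium_density (alpha gamma mu T : R) (t : R) : R :=
  if - (gamma / alpha)
       * (1 - expR (- (mu * T / (1 + alpha / (gamma * mu))))
              / (1 + gamma * mu / alpha))^-1 <= t < 0
  then alpha / (gamma + alpha / mu)
  else if 0 <= t <= T
  then mu / ((1 + alpha / (gamma * mu))
             * (1 + gamma * mu / alpha
                - expR (- (mu * T / (1 + alpha / (gamma * mu))))))
       * expR (- (mu * t / (1 + alpha / (gamma * mu))))
  else 0.

Definition equilibrium_cost (alpha gamma mu T : R) : R :=
  gamma * (1 - expR (- (mu * T / (1 + alpha / (gamma * mu))))
               / (1 + gamma * mu / alpha))^-1.

End Model.

(* Main.v *)
(* Let beta = gamma + alpha / mu and let S(t) be the probability that the other
   customer has been served by time t. Up to null events, whoever is ahead is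
   either present or served, so that
     c_F(t) = alpha t^- + beta (F(t-) + F(t)) / 2 - (alpha / mu) S(t),
   where S is nondecreasing and Lipschitz and S(t) is the integral over [0, t]
   of mu exp(- mu x) F(t - x) dx.

   In an equilibrium an atom at t would make it profitable to arrive slightly
   before t, hence F is continuous. If F(t) > 0, the leftmost s with F(s) = F(t)
   is in the support and c_F(t) <= c_F(s) = c_e, hence c_F(t) = c_e. For t <= 0
   this determines F; on [0, T] it is a fixed-point equation whose integral term
   is a contraction with factor alpha / (mu beta) < 1. Then F(T) = 1 determines
   c_e. Conversely, the explicit cdf solves these equations. *)
Require Import Defs.
From mathcomp Require Import all_boot all_order all_algebra.
From mathcomp Require Import all_classical all_reals all_analysis.
Local Open Scope ring_scope.
From HB Require Import structures.
From mathcomp Require Import measurable_realfun.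
From mathcomp Require Import ring lra.

Import Order.TTheory GRing.Theory Num.Theory.
Import numFieldNormedType.Exports.

Set Implicit Arguments.
Unset Strict Implicit.
Unset Printing Implicit Defensive.

(** * The arrival law and the law of the other customer *)

Section arrival_law.
Local Open Scope classical_set_scope.
Context {R : realType}.
Implicit Types (F : cdf_on R) (s t : R).

Lemma arrival_lawNyc F t : arrival_law F `]-oo, t] = (F t)%:E.
Proof.
rewrite -(cdf_lebesgue_stieltjes_id F t).
by rewrite /cdf /distribution /pushforward preimage_id.
Qed.

Lemma cdf_on_ge0 F t : 0 <= F t.
Proof. by rewrite -lee_fin -arrival_lawNyc. Qed.

Lemma cdf_on_le1 F t : F t <= 1.
Proof. by rewrite -lee_fin -arrival_lawNyc probability_le1. Qed.

Lemma cdf_on_homo F : {homo F : x y / x <= y}.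
Proof. exact: cumulative_is_nondecreasing. Qed.

Lemma measurable_cdf F : measurable_fun setT F.
Proof. by apply: nondecreasing_measurable => //; exact: cdf_on_homo. Qed.

(** The left limit of [F] at [t], encoded as the mass of the open half-line so that no limit has to
    be taken. *)
Definition cdf_left F t : R := fine (arrival_law F `]-oo, t[).

Lemma cdf_leftE F t : arrival_law F `]-oo, t[ = (cdf_left F t)%:E.
Proof. by rewrite /cdf_left fineK// fin_num_measure. Qed.

Lemma cdf_left_le F t : cdf_left F t <= F t.
Proof.
rewrite -lee_fin -cdf_leftE -arrival_lawNyc.
by apply: le_measure; rewrite ?inE//; apply: subset_itvl; rewrite bnd_simp.
Qed.

Lemma cdf_left_ge F s t : s < t -> F s <= cdf_left F t.
Proof.
move=> st; rewrite -lee_fin -cdf_leftE -arrival_lawNyc.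
by apply: le_measure; rewrite ?inE//; apply: subset_itvl; rewrite bnd_simp// ltW.
Qed.

Lemma arrival_lawoc F s t : s <= t -> arrival_law F `]s, t] = (F t - F s)%:E.
Proof.
move=> st.
change (lebesgue_stieltjes_measure F `]s, t] = (F t - F s)%:E).
rewrite /lebesgue_stieltjes_measure /measure_extension.
by rewrite measurable_mu_extE/= ?wlength_itv_bnd//; exact: is_ocitv.
Qed.

Lemma arrival_law1 F t : arrival_law F [set t] = (F t - cdf_left F t)%:E.
Proof.
rewrite EFinB -arrival_lawNyc -cdf_leftE.
have -> : `]-oo, t]%classic = `]-oo, t[%classic `|` [set t].
  by rewrite setUitv1// bnd_simp.
rewrite measureU//; last first.
  by apply/seteqP; split => // x [/= + xt]; rewrite xt in_itv/= ltxx.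
by rewrite addeAC subee ?add0e// fin_num_measure.
Qed.

End arrival_law.

Section other_law.
Local Open Scope classical_set_scope.
Context {R : realType} (mu : R) (mu_gt0 : 0 < mu).
Implicit Types (F : cdf_on R) (s t : R).

Lemma other_law_rect F (A B : set (measurableTypeR R)) (C : set bool) :
  measurable A -> measurable B ->
  other_law mu_gt0 F ((A `*` B) `*` C) =
  (arrival_law F A * service_law mu_gt0 B * bernoulli_prob (2^-1 : R) C)%E.
Proof.
move=> mA mB.
have mAB : measurable (A `*` B) by exact: measurableX.
have mC : measurable C by [].
etransitivity; first exact: (product_measure1E _ _ mAB mC).
congr (_ * _)%E; exact: (product_measure1E _ _ mA mB).
Qed.

Definition ahead_set t : set (measurableTypeR R * measurableTypeR R * bool) :=
  [set w | other_ahead t w].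
Definition present_set t : set (measurableTypeR R * measurableTypeR R * bool) :=
  [set w | other_present t w].

(* The strict inequality makes a customer served by time [t] arrive before [t],
   so that ties play no role; it only discards a null event. *)
Definition served_set t : set (measurableTypeR R * measurableTypeR R) :=
  [set z | 0 < z.2 /\ Num.max z.1 0 + z.2 <= t].

Lemma ahead_setE t : ahead_set t =
  ((`]-oo, t[ `*` setT) `*` setT) `|` (([set t] `*` setT) `*` [set true]).
Proof.
apply/seteqP; split => [[[s x] b]|[[s x] b]]; rewrite /ahead_set /other_ahead/=.
  by move=> /orP[st|/andP[/eqP -> ->]]; [left; rewrite in_itv|right].
by rewrite in_itv/= => -[[[-> _] _]|[[-> _] ->]] //; rewrite eqxx orbT.
Qed.

Lemma measurable_ahead_set t : measurable (ahead_set t).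
Proof.
rewrite ahead_setE; apply: measurableU.
  by apply: measurableX => //; apply: measurableX.
by apply: measurableX => //; apply: measurableX.
Qed.

Lemma bernoulli_half_true : bernoulli_prob (2^-1 : R) [set true] = (2^-1)%:E.
Proof.
rewrite /bernoulli_prob fsbig_set1 /bernoulli_pmf ifT//.
by apply/andP; split; lra.
Qed.

(** The fair coin counts half of the atom at [t]: F(t-) + (F(t) - F(t-)) / 2. *)
Lemma other_law_ahead F t :
  other_law mu_gt0 F (ahead_set t) = ((cdf_left F t + F t) / 2)%:E.
Proof.
rewrite ahead_setE measureU//; first last.
- apply/seteqP; split => // -[[s x] b] [[[/= + _] _] [[/= st _] _]].
  by rewrite st in_itv/= ltxx.
- by apply: measurableX => //; apply: measurableX.
- by apply: measurableX => //; apply: measurableX.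
transitivity ((cdf_left F t)%:E + ((F t - cdf_left F t) / 2)%:E)%E; last first.
  by rewrite -EFinD; congr (_%:E); lra.
congr (_ + _)%E.
  etransitivity; first exact: (@other_law_rect F `]-oo, t[ setT setT).
  by rewrite [X in (_ * _ * X)%E]probability_setT probability_setT !mule1 cdf_leftE.
etransitivity; first exact: (@other_law_rect F [set t] setT [set true]).
by rewrite bernoulli_half_true probability_setT mule1 arrival_law1.
Qed.

End other_law.

(** * Exponential service times and measurability of the events *)

Section service.
Local Open Scope classical_set_scope.
Context {R : realType} (mu : R) (mu_gt0 : 0 < mu).
Implicit Types (F : cdf_on R) (s t : R).

Lemma measurable_exponential_pdfE (D : set R) :
  measurable_fun D (fun x : R => (exponential_pdf mu x)%:E).
Proof.
by apply/measurable_funTS/measurable_EFinP; exact: measurable_exponential_pdf.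
Qed.

Lemma service_lawE (A : set (measurableTypeR R)) :
  service_law mu_gt0 A =
  (\int[lebesgue_measure]_(x in A) (exponential_pdf mu x)%:E)%E.
Proof. by []. Qed.

Lemma exponential_pdf_le t : exponential_pdf mu t <= mu.
Proof.
have [t0|t0] := ltP t 0; first by rewrite lt0_exponential_pdf// ltW.
rewrite exponential_pdfE// ler_piMr ?(ltW mu_gt0)//.
by rewrite -expR0 ler_expR mulNr oppr_le0 mulr_ge0// ltW.
Qed.

Lemma service_law_le0 : service_law mu_gt0 `]-oo, 0%R] = 0%E.
Proof.
rewrite service_lawE -integral_itv_bndo_bndc; last first.
  exact: measurable_exponential_pdfE.
apply: integral0_eq => x; rewrite /= in_itv/= => x0.
by rewrite lt0_exponential_pdf.
Qed.

(** The exponential density is at most [mu]; this becomes the Lipschitz constant of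
    [served_prob]. *)
Lemma service_law_oc_le s t : s <= t ->
  (service_law mu_gt0 `]s, t] <= (mu * (t - s))%:E)%E.
Proof.
move=> st; rewrite service_lawE.
apply: (@le_trans _ _ (\int[lebesgue_measure]_(x in `]s, t]) mu%:E)%E).
  apply: ge0_le_integral => //.
  - by move=> x _; rewrite lee_fin exponential_pdf_ge0// ltW.
  - exact: measurable_exponential_pdfE.
  - by move=> x _; rewrite lee_fin exponential_pdf_le.
rewrite integral_cst//= lebesgue_measure_itv/= lte_fin.
case: ifPn => _; first by rewrite -EFinB -EFinM.
by rewrite mule0 lee_fin mulr_ge0 ?subr_ge0// ltW.
Qed.

Lemma measurable_start_plus_service :
  measurable_fun setT (fun z : measurableTypeR R * measurableTypeR R =>
    Num.max z.1 0 + z.2).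
Proof.
apply: measurable_funD => //.
by apply: measurable_maxr.
Qed.

Lemma measurable_served_set t : measurable (served_set t).
Proof.
have -> : served_set t = (snd @^-1` `]0, +oo[) `&`
    ((fun z : measurableTypeR R * measurableTypeR R => Num.max z.1 0 + z.2)
      @^-1` `]-oo, t]).
  by apply/seteqP; split => z; rewrite /served_set/= !in_itv/= andbT.
apply: measurableI.
  by rewrite -[X in measurable X]setTI; apply: measurable_snd.
by rewrite -[X in measurable X]setTI; apply: measurable_start_plus_service.
Qed.

Lemma measurable_present_set t : measurable (present_set t).
Proof.
have -> : present_set t = ahead_set t `&`
    ((fun w : measurableTypeR R * measurableTypeR R * bool =>
      Num.max w.1.1 0 + w.1.2) @^-1` `]t, +oo[).
  apply/seteqP; split => w; rewrite /present_set /other_present/= in_itv/= andbT.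
    by move=> /andP[].
  by move=> [-> ->].
apply: measurableI; first exact: measurable_ahead_set.
rewrite -[X in measurable X]setTI.
apply: (measurableT_comp measurable_start_plus_service measurable_fst) => //.
Qed.

End service.

(** * Delayed integrals against the exponential density *)

Section delayed_integral.
Local Open Scope classical_set_scope.
Context {R : realType} (mu : R) (mu_gt0 : 0 < mu).
Implicit Types (s t : R) (h : R -> R).

(** A convolution with the service density, extended-real valued so that the calculus of nonnegative
    integrals applies directly. *)
Definition delayed h t : \bar R :=
  (\int[lebesgue_measure]_(x in `[0%R, t]) (mu * expR (- mu * x) * h (t - x))%R%:E)%E.

Lemma measurable_delayed h t : measurable_fun setT h ->
  measurable_fun setT (fun x : R => (mu * expR (- mu * x) * h (t - x))%:E).
Proof.
move=> mh; apply/measurable_EFinP; apply: measurable_funM.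
  by apply: measurable_funM => //; apply: measurableT_comp => //.
by apply: measurableT_comp => //; exact: measurable_funB.
Qed.

Lemma delayed_cst t M : 0 <= M -> (delayed (cst M) t <= M%:E)%E.
Proof.
move=> M0; rewrite -[leRHS]mul1e.
apply: (@le_trans _ _ (service_law mu_gt0 `[0%R, t] * M%:E)%E); last first.
  by rewrite lee_wpmul2r ?lee_fin// probability_le1.
rewrite service_lawE -ge0_integralZr//; last 2 first.
  - exact: measurable_exponential_pdfE.
  - by move=> x _; rewrite lee_fin exponential_pdf_ge0// ltW.
rewrite le_eqVlt; apply/orP; left; apply/eqP; apply: eq_integral => x /set_mem/=.
by rewrite in_itv/= => /andP[x0 _]; rewrite exponential_pdfE.
Qed.

(** The kernel has mass at most 1, so a pointwise excess of at most [M] stays one after integration.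
    Used in both directions, this bounds a supremum distance. *)
Lemma delayed_le h1 h2 t M : measurable_fun setT h1 -> measurable_fun setT h2 ->
  0 <= M -> {in `[0, t]%R, forall x, 0 <= h1 x} ->
  {in `[0, t]%R, forall x, 0 <= h2 x} ->
  {in `[0, t]%R, forall x, h1 x <= h2 x + M} ->
  (delayed h1 t <= delayed h2 t + M%:E)%E.
Proof.
move=> mh1 mh2 M0 h10 h20 h12.
have p0 x : 0 <= mu * expR (- mu * x) by rewrite mulr_ge0 ?expR_ge0// ltW.
have tx x : x \in `[0, t]%R -> t - x \in `[0, t]%R.
  by rewrite !in_itv/= => /andP[x0 xt]; apply/andP; split; lra.
apply: (@le_trans _ _ (delayed h2 t + delayed (cst M) t)%E); last first.
  by rewrite leeD2l// delayed_cst.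
rewrite /delayed -ge0_integralD//; last 4 first.
- by move=> x x0t; rewrite lee_fin mulr_ge0// h20// tx.
- exact: measurable_funTS (measurable_delayed _ _).
- by move=> x x0t; rewrite lee_fin mulr_ge0.
- exact: measurable_funTS (measurable_delayed _ _).
apply: ge0_le_integral => //.
- by move=> x x0t; rewrite lee_fin mulr_ge0// h10// tx.
- exact: measurable_funTS (measurable_delayed _ _).
- by apply: emeasurable_funD; exact: measurable_funTS (measurable_delayed _ _).
- by move=> x x0t; rewrite -EFinD lee_fin -mulrDr ler_wpM2l// h12// tx.
Qed.

End delayed_integral.

(** * Closed forms for integrals of exponentials *)

Section exponential_integrals.
Local Open Scope classical_set_scope.
Context {R : realType}.
Implicit Types (a b c p q t x : R) (f : R -> R).

Lemma is_derive_expR_affine c p q x :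
  is_derive x 1 (fun y : R => c * expR (p * y + q)) (c * p * expR (p * x + q)).
Proof.
have h : is_derive x (1 : R) (fun y : R => p * y + q) p.
  apply: is_derive_eq; rewrite addr0 [X in _ *: X]/= /GRing.scale/=; ring.
have := @is_deriveZ _ _ _ (fun y : R => expR (p * y + q)) c x 1 _
  (@is_derive1_comp _ expR (fun y : R => p * y + q) x _ _ (is_derive_expR _) h).
move=> k; apply: (is_derive_eq k); rewrite /GRing.scale/=; ring.
Qed.

Lemma continuous_expR_affine c p q : continuous (fun x : R => c * expR (p * x + q)).
Proof.
move=> x; apply: differentiable_continuous; apply/derivable1_diffP.
exact: (@ex_derive _ _ _ _ _ _ _ (is_derive_expR_affine c p q x)).
Qed.

Lemma integral_derive f (f' : R -> R) a b : a <= b ->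
  (forall x, is_derive x 1 f (f' x)) -> continuous f' ->
  (\int[lebesgue_measure]_(x in `[a, b]) (f' x)%:E)%E = (f b - f a)%:E.
Proof.
(* The degenerate interval is treated apart; there both sides vanish. *)
rewrite le_eqVlt => /predU1P[->|ab] df cf'.
  by rewrite set_itv1 integral_set1 subrr.
have cf : continuous f.
  move=> x; apply: differentiable_continuous; apply/derivable1_diffP.
  exact: (@ex_derive _ _ _ _ _ _ _ (df x)).
rewrite (@continuous_FTC2 _ f' f)//.
- exact: continuous_subspaceT.
- split.
  + by move=> x _; exact: (@ex_derive _ _ _ _ _ _ _ (df x)).
  + exact: cvg_at_right_filter (cf a).
  + exact: cvg_at_left_filter (cf b).
- by move=> x _; rewrite derive1E; exact: (@derive_val _ _ _ _ _ _ _ (df x)).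
Qed.

(** As a function of [x] the integrand is a sum of two exponentials; [nu != mu] keeps the second
    from being constant, so both have exponential antiderivatives, collected in [A]. *)
Lemma delayed_expR (mu nu a b t : R) : nu != mu -> 0 <= t ->
  delayed mu (fun u => a - b * expR (- nu * u)) t =
  (a * (1 - expR (- mu * t))
   - b * (mu / (mu - nu)) * (expR (- nu * t) - expR (- mu * t)))%:E.
Proof.
move=> numu t0; rewrite /delayed.
pose c := b * (mu / (mu - nu)).
pose A x := - a * expR (- mu * x + 0) + c * expR ((nu - mu) * x - nu * t).
pose A' x := - a * - mu * expR (- mu * x + 0)
  + c * (nu - mu) * expR ((nu - mu) * x - nu * t).
have munu : mu - nu != 0 by rewrite subr_eq0 eq_sym.
transitivity (\int[lebesgue_measure]_(x in `[0%R, t]) (A' x)%:E)%E.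
  apply: eq_integral => x _; congr (_%:E); rewrite /A' /c.
  have -> : (nu - mu) * x - nu * t = - mu * x + - nu * (t - x) by ring.
  rewrite addr0 expRD; field.
  by rewrite munu.
have dA x : is_derive x 1 A (A' x).
  by apply: is_deriveD; exact: is_derive_expR_affine.
have cA' : continuous A'.
  by move=> x; apply: cvgD; exact: continuous_expR_affine.
rewrite (integral_derive t0 dA cA') /A /c; congr (_%:E).
have -> : (nu - mu) * t - nu * t = - mu * t by ring.
have -> : (nu - mu) * 0 - nu * t = - nu * t by ring.
by rewrite !addr0 mulr0 expR0; ring.
Qed.

End exponential_integrals.

(** * The expected cost *)

Section served.
Local Open Scope classical_set_scope.
Context {R : realType} (mu : R) (mu_gt0 : 0 < mu).
Implicit Types (F : cdf_on R) (s t : R).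

Let law F : probability (measurableTypeR R * measurableTypeR R)%type R :=
  (arrival_law F \x service_law mu_gt0)%E.

Definition served_prob F t : R := fine (law F (served_set t)).

Lemma served_probE F t : law F (served_set t) = (served_prob F t)%:E.
Proof.
by rewrite /served_prob fineK// fin_num_measure//; exact: measurable_served_set.
Qed.

Lemma served_prob_le1 F t : served_prob F t <= 1.
Proof.
rewrite -lee_fin -served_probE probability_le1//.
exact: measurable_served_set.
Qed.

Lemma served_prob_homo F : {homo served_prob F : s t / s <= t}.
Proof.
move=> s t st.
suff : (law F (served_set s) <= law F (served_set t))%E.
  by rewrite !served_probE lee_fin.
apply: le_measure; rewrite ?inE; [exact: measurable_served_set..|].
by move=> z [z0 zs]; split => //; exact: le_trans st.
Qed.

(** On the event [served_set], service starts no earlier than 0 and takes positive time. *)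
Lemma served_prob_le0 F t : t <= 0 -> served_prob F t = 0.
Proof.
move=> t0; suff -> : served_prob F t = fine (law F set0) by rewrite measure0.
congr (fine (law F _)); apply/seteqP; split => // z [z0].
have : 0 <= Num.max z.1 0 by rewrite le_max lexx orbT.
by move=> h1 h2; lra.
Qed.

Lemma law_xsection F t : law F (served_set t) =
  (\int[arrival_law F]_s service_law mu_gt0 (xsection (served_set t) s))%E.
Proof. by []. Qed.

(** Given an arrival at [a], service ends in (s, t] only if its duration lies in an interval of
    length t - s, which has mass at most mu (t - s). Integrating over [a] keeps the bound. *)
Lemma served_prob_lipschitz F s t : s <= t ->
  served_prob F t <= served_prob F s + mu * (t - s).
Proof.
move=> st.
suff : (law F (served_set t) <= law F (served_set s) + (mu * (t - s))%:E)%E.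
  by rewrite !served_probE -EFinD lee_fin.
rewrite !law_xsection.
have -> : (mu * (t - s))%:E = (\int[arrival_law F]_x (mu * (t - s))%:E)%E.
  rewrite integral_cst//; transitivity ((mu * (t - s))%:E * 1)%E.
    by rewrite mule1.
  by congr (_ * _)%E; rewrite -(probability_setT (arrival_law F)).
have mts : 0 <= mu * (t - s) by rewrite mulr_ge0 ?subr_ge0// ltW.
rewrite -ge0_integralD//; last first.
  by apply: measurable_fun_xsection; exact: measurable_served_set.
apply: ge0_le_integral => //.
- by apply: measurable_fun_xsection; exact: measurable_served_set.
- apply: emeasurable_funD => //.
  by apply: measurable_fun_xsection; exact: measurable_served_set.
move=> a _; set m := Num.max (a : R) 0.
have -> : (mu * (t - s) = mu * ((t - m) - (s - m)))%R by ring.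
pose A : set (measurableTypeR R) := `]s - m, t - m]%classic.
apply: (@le_trans _ _ (service_law mu_gt0 (xsection (served_set s) a) +
   service_law mu_gt0 A)%E); last first.
  by rewrite leeD2l// service_law_oc_le// lerD2r.
have mX : measurable (xsection (served_set s) a).
  by apply: measurable_xsection; exact: measurable_served_set.
have mA : measurable A by exact: measurable_itv.
apply: (@le_trans _ _ (service_law mu_gt0 (xsection (served_set s) a `|` A))); last first.
  exact: (measureU2 (service_law mu_gt0) mX mA).
apply: le_measure; rewrite ?inE.
- by apply: measurable_xsection; exact: measurable_served_set.
- exact: measurableU.
move=> x /xsectionP[/= x0 xt].
have [xs|xs] := leP x (s - m).
  by left; apply/xsectionP; split => //=; rewrite -/m -lerBrDl.
by right; rewrite /A /= in_itv/= xs/= lerBrDl.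
Qed.

(** By Tonelli, fix the duration x in (0, t] first. Since t - x is nonnegative, the service ends by
    [t] exactly when the arrival time is at most t - x, which has probability F(t - x). *)
Lemma served_prob_delayed F t : (served_prob F t)%:E = delayed mu F t.
Proof.
rewrite -served_probE law_xsection /delayed.
pose g (z : measurableTypeR R * measurableTypeR R) :=
  (\1_(served_set t) z * exponential_pdf mu z.2)%:E.
have g0 z : (0 <= g z)%E.
  by rewrite lee_fin mulr_ge0// exponential_pdf_ge0// ltW.
have mg : measurable_fun setT g.
  apply/measurable_EFinP; apply: measurable_funM.
    by apply: measurable_indic; exact: measurable_served_set.
  by apply: (measurableT_comp (measurable_exponential_pdf _)) => //.
transitivity (\int[arrival_law F]_s \int[lebesgue_measure]_x g (s, x))%E.
  apply: eq_integral => s _; rewrite service_lawE integral_mkcond.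
  apply: eq_integral => x _; rewrite patchE /g/= indicE mem_xsection.
  by case: ifPn => _; rewrite ?mul1r ?mul0r.
rewrite fubini_tonelli//.
(* [served_set] contains only positive durations, so the null endpoint 0 is dropped. *)
rewrite -integral_itv_obnd_cbnd; last first.
  exact: measurable_funTS (measurable_delayed _ _ (measurable_cdf F)).
rewrite [RHS]integral_mkcond; apply: eq_integral => x _.
transitivity ((exponential_pdf mu x)%:E *
    (\int[arrival_law F]_s (\1_(ysection (served_set t) x) s)%:E))%E.
  rewrite -ge0_integralZl//.
  - by apply: eq_integral => s _; rewrite /g/= mulrC EFinM !indicE mem_ysection.
  - apply/measurable_EFinP/measurable_indic; apply: measurable_ysection.
    exact: measurable_served_set.
  - by rewrite lee_fin exponential_pdf_ge0// ltW.
rewrite integral_indic//; last first.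
  by apply: measurable_ysection; exact: measurable_served_set.
rewrite setIT patchE.
case: ifPn => [/set_mem/=|/negP h].
  rewrite in_itv/=.
  move=> /andP[x0 xt].
  rewrite (_ : ysection _ _ = `]-oo, t - x]); last first.
    apply/seteqP; split => s; rewrite /= in_itv/=.
      move=> /ysectionP[/= _]; rewrite -lerBrDr => sx.
      by apply: le_trans sx; rewrite le_max lexx.
    move=> sx; apply/ysectionP; split => //=; rewrite -lerBrDr ge_max sx/=; lra.
  rewrite arrival_lawNyc exponential_pdfE ?(ltW x0)//.
rewrite (_ : ysection _ _ = set0) ?measure0 ?mule0//.
apply/seteqP; split => // s /ysectionP[/= x0 sx]; apply: h; apply: mem_set.
rewrite /= in_itv/= x0/=.
have : 0 <= Num.max (s : R) 0 by rewrite le_max lexx orbT.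
lra.
Qed.

End served.

(** * The cost formula and the support *)

Section cost.
Local Open Scope classical_set_scope.
Context {R : realType} (mu : R) (mu_gt0 : 0 < mu).
Implicit Types (F : cdf_on R) (s t : R).

(** Off the event [N] of nonpositive service times, a customer ahead is either still present or
    served; conversely, a served one arrived strictly before [t], hence is ahead whatever the coin
    shows. *)
Lemma ahead_set_decomp t :
  let N : set (measurableTypeR R * measurableTypeR R * bool) :=
    (setT `*` `]-oo, 0%R]) `*` setT in
  ahead_set t `|` N = (present_set t `|` (served_set t `*` setT)) `|` N.
Proof.
move=> N; apply/seteqP.
rewrite /N /ahead_set /present_set /other_present /served_set /other_ahead.
split => -[[s x] b] /=; rewrite in_itv/=.
  move=> [->|/= [[_ x0] _]]; last by right.
  have [x0|x0] := leP x 0; first by right.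
  left; have [xt|tx] := leP (Num.max s 0 + x) t; last by left.
  by right.
move=> [[/andP[-> _]|[[x0 sxt] _]]|h]; [by left| |by right].
by left; rewrite (_ : s < t)//; have : s <= Num.max s 0 by [rewrite le_max lexx]; lra.
Qed.

(** [N] is null, and presence and completed service exclude each other, so the served probability is
    subtracted from that of being ahead. *)
Lemma other_law_present F t : other_law mu_gt0 F (present_set t) =
  ((cdf_left F t + F t) / 2 - served_prob mu_gt0 F t)%:E.
Proof.
pose N : set (measurableTypeR R * measurableTypeR R * bool) :=
  (setT `*` `]-oo, 0%R]) `*` setT.
have mserved : measurable (served_set t `*` [set: bool]).
  by apply: measurableX => //; exact: measurable_served_set.
have mN : measurable N by apply: measurableX => //; exact: measurableX.
have N0 : other_law mu_gt0 F N = 0%E.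
  etransitivity; first exact: (@other_law_rect _ _ _ F setT `]-oo, 0%R] setT).
  by rewrite service_law_le0 mule0 mul0e.
have servedE : other_law mu_gt0 F (served_set t `*` setT) =
               (served_prob mu_gt0 F t)%:E.
  rewrite -served_probE.
  etransitivity.
    exact: (product_measure1E _ _ (measurable_served_set t)
      (measurableT : measurable [set: bool])).
  transitivity ((arrival_law F \x service_law mu_gt0)%E (served_set t) * 1)%E.
    by congr (_ * _)%E; exact: probability_setT.
  by rewrite mule1.
have mp := measurable_present_set t; have ma := measurable_ahead_set t.
have : other_law mu_gt0 F (ahead_set t) =
    (other_law mu_gt0 F (present_set t) + (served_prob mu_gt0 F t)%:E)%E.
  rewrite -(measureU0 ma mN N0) ahead_set_decomp -servedE.
  rewrite (measureU0 _ mN N0)//; last exact: measurableU.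
  rewrite measureU//; apply/seteqP; split => // -[[s x] b].
  rewrite /present_set /other_present /served_set/= => -[/andP[_ h] [[_ h'] _]].
  by move: h; rewrite ltNge h'.
rewrite other_law_ahead => /(congr1 (fun x => x - (served_prob mu_gt0 F t)%:E)%E).
by rewrite EFinB => ->; rewrite addeK.
Qed.

Definition wait_before_opening t : R := Num.max (- t) 0.

Lemma wait_before_opening_le s t : s <= t ->
  wait_before_opening t <= wait_before_opening s <= wait_before_opening t + (t - s).
Proof.
rewrite /wait_before_opening => st; apply/andP; split.
  by rewrite ge_max !le_max lerN2 st lexx orbT.
rewrite ge_max; apply/andP; split.
  have : - t <= Num.max (- t) 0 by rewrite le_max lexx.
  lra.
have : 0 <= Num.max (- t) 0 by rewrite le_max lexx orbT.
lra.
Qed.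

(** Presence is being ahead minus being served, so the probability of being ahead carries both the
    index cost and the waiting cost. *)
Lemma expected_costE (alpha gamma : R) F t :
  expected_cost alpha gamma mu_gt0 F t =
  (alpha * wait_before_opening t + (gamma + alpha / mu) * ((cdf_left F t + F t) / 2)
   - alpha / mu * served_prob mu_gt0 F t)%:E.
Proof.
rewrite /expected_cost /wait_before_opening.
have -> : ahead_indicator t = \1_(ahead_set t).
  by apply/funext => w; rewrite indicE mem_setE.
have -> : present_indicator t = \1_(present_set t).
  by apply/funext => w; rewrite indicE mem_setE.
rewrite !expectation_indic; [|exact: measurable_ahead_set|exact: measurable_present_set].
rewrite other_law_ahead other_law_present -!EFinM -!EFinD; congr (_%:E).
suff -> : - alpha * t * (t < 0)%R%:R = alpha * Num.max (- t) 0 by ring.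
have [t0|t0] := ltP t 0; rewrite /= ?mulr1 ?mulr0.
  by rewrite max_l ?oppr_ge0 ?ltW// mulrN mulNr.
by rewrite max_r ?mulr0// oppr_le0.
Qed.

Lemma cdf_supportP F t :
  cdf_support F t <-> forall e : R, 0 < e -> F (t - e) < F (t + e).
Proof.
split=> [h e e0|h e e0].
  rewrite -subr_gt0 -lte_fin -arrival_lawoc; last by lra.
  apply: lt_le_trans (h e e0) _.
  by apply: le_measure; rewrite ?inE//; apply: subset_itvl; rewrite bnd_simp.
(* Halving [e] fits the half-open interval inside the open one. *)
have e20 : 0 < e / 2 by lra.
have := h _ e20; rewrite -subr_gt0 -lte_fin -arrival_lawoc; last by lra.
move=> /lt_le_trans; apply.
apply: le_measure; rewrite ?inE//.
by apply: subset_itv; rewrite bnd_simp; lra.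
Qed.

End cost.

(** * From an equilibrium to its cdf *)

Section equilibrium.
Local Open Scope classical_set_scope.
Context {R : realType} (alpha gamma mu T : R).
Hypotheses (alpha_gt0 : 0 < alpha) (gamma_gt0 : 0 < gamma) (mu_gt0 : 0 < mu)
  (T_gt0 : 0 < T).
Implicit Types (F : cdf_on R) (c s t u : R).

(* The marginal cost of one unit of arrival probability before opening, when
   whoever is ahead is also present. *)
Definition total_rate := gamma + alpha / mu.
(** Equals mu / (1 + alpha / (gamma mu)), the rate in the exponent of the stated density. It arises
    from differentiating the cost equation on [0, T]. *)
Definition decay_rate := mu * gamma / total_rate.
Let beta := total_rate.
Let kappa := decay_rate.

(* The cdf on [0, T] that keeps the expected cost equal to [c]. *)
Definition open_cdf c u := c / gamma
  - c / gamma * (alpha / (mu * beta)) * expR (- kappa * u).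

Lemma open_cdf_affineE c : open_cdf c = cst (c / gamma) \+
  (fun u => - (c / gamma * (alpha / (mu * beta))) * expR (- kappa * u + 0)).
Proof. by apply/funext => u; rewrite /open_cdf /= addr0; ring. Qed.

Lemma open_cdf_continuous c : continuous (open_cdf c).
Proof.
move=> u; rewrite open_cdf_affineE.
by apply: cvgD; [exact: cvg_cst|exact: continuous_expR_affine].
Qed.

Let alphamu_gt0 : 0 < alpha / mu. Proof. exact: divr_gt0. Qed.

Lemma total_rate_gt0 : 0 < beta. Proof. exact: addr_gt0. Qed.

Let beta_gt0 := total_rate_gt0.

Lemma mul_total_rate : mu * beta = gamma * mu + alpha.
Proof. by rewrite /beta /total_rate; field; rewrite gt_eqF. Qed.

(** [mu * beta] exceeds [alpha] by [gamma * mu]. This ratio is the contraction factor. *)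
Lemma congestion_ratio_lt1 : alpha / (mu * beta) < 1.
Proof.
rewrite mul_total_rate ltr_pdivrMr ?mul1r ?ltrDr ?mulr_gt0//.
by rewrite addr_gt0// mulr_gt0.
Qed.

Lemma congestion_ratio_gt0 : 0 < alpha / (mu * beta).
Proof. by rewrite divr_gt0// mulr_gt0. Qed.

Let theta_lt1 := congestion_ratio_lt1.
Let theta_gt0 := congestion_ratio_gt0.

Lemma decay_rate_gt0 : 0 < kappa.
Proof. by rewrite divr_gt0// mulr_gt0. Qed.

(** The coefficient alpha / (mu beta) in [open_cdf] is the inverse of mu / (mu - kappa), so the
    terms in exp(- mu t) cancel. *)
Lemma delayed_open_cdf c t : 0 <= t ->
  delayed mu (open_cdf c) t = (c / gamma * (1 - expR (- kappa * t)))%:E.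
Proof.
have numu : kappa != mu.
  rewrite lt_eqF// /kappa /decay_rate -mulrA gtr_pMr//.
  by rewrite ltr_pdivrMr// mul1r ltrDl.
move=> t0; rewrite /open_cdf delayed_expR//; congr (_%:E).
have -> : mu / (mu - kappa) = mu * beta / alpha.
  rewrite /kappa /decay_rate -/beta.
  have -> : mu - mu * gamma / beta = alpha / beta.
    rewrite -[X in X - _](mulfK (lt0r_neq0 beta_gt0)) -mulrBl mul_total_rate.
    by congr (_ / _); ring.
  by field; rewrite !gt_eqF.
by field; rewrite !gt_eqF.
Qed.

Lemma open_cdf_homo c : 0 < c -> {homo open_cdf c : s t / s <= t}.
Proof.
move=> c0 s t st; rewrite lerD2l lerN2 ler_pM2l; last first.
  by rewrite mulr_gt0// divr_gt0.
rewrite ler_expR !mulNr lerN2 ler_pM2l//.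
exact: decay_rate_gt0.
Qed.

Lemma open_cdf0 c : open_cdf c 0 = c / beta.
Proof.
rewrite /open_cdf mulr0 expR0 mul_total_rate /beta.
have -> : c / total_rate = c * mu / (gamma * mu + alpha).
  by rewrite -mul_total_rate -/beta; field; rewrite !gt_eqF.
field; rewrite !gt_eqF//.
by rewrite addr_gt0// mulr_gt0.
Qed.

(* The coefficient [alpha / (mu * beta)] is smaller than [1], so the cost
   equation is a contraction for the supremum norm on [0, T]. *)
Lemma open_cdf_unique F c : 0 < c ->
  (forall t, 0 <= t <= T ->
    beta * F t - alpha / mu * served_prob mu_gt0 F t = c) ->
  forall t, 0 <= t <= T -> F t = open_cdf c t.
Proof.
move=> c0 eqF.
(* Both functions are bounded on [0, T], so the deviations have a finite supremum [M]; the aim is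
   [M <= 0]. *)
pose E : set R := [set `|F t - open_cdf c t| | t in `[0, T]].
have G0 t : 0 <= t -> 0 <= open_cdf c t.
  move=> t0; apply: le_trans (open_cdf_homo c0 t0).
  by rewrite open_cdf0 divr_ge0// ltW.
have Gle t : open_cdf c t <= c / gamma.
  rewrite gerBl; apply: mulr_ge0; last exact: expR_ge0.
  by apply: mulr_ge0; [rewrite divr_ge0// ltW|exact: ltW].
have hsE : has_sup E.
  split; first by exists `|F 0 - open_cdf c 0|, 0 => //; rewrite /= in_itv/= lexx ltW.
  exists (1 + c / gamma) => y [u + <-]; rewrite /= in_itv/= => /andP[u0 uT].
  have := G0 u u0; have := Gle u; have := cdf_on_ge0 F u; have := cdf_on_le1 F u.
  by move=> *; rewrite ler_norml; apply/andP; split; lra.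
pose M := sup E.
have leM t : 0 <= t <= T -> `|F t - open_cdf c t| <= M.
  by move=> tT; apply: (sup_upper_bound hsE); exists t => //; rewrite /= in_itv.
have M0 : 0 <= M.
  by apply: le_trans (leM 0 _); rewrite ?normr_ge0// lexx ltW.
have mG : measurable_fun setT (open_cdf c).
  by apply: nondecreasing_measurable => //; exact: open_cdf_homo.
have mF := measurable_cdf F.
have contr t : 0 <= t <= T -> `|F t - open_cdf c t| <= alpha / (mu * beta) * M.
  move=> /andP[t0 tT].
  have sub x : x \in `[0, t]%R -> 0 <= x <= T.
    by rewrite in_itv/= => /andP[-> xt]/=; exact: le_trans tT.
  (* The two one-sided comparisons bound the difference of the served terms by [M]. *)
  have h1 : (delayed mu F t <= delayed mu (open_cdf c) t + M%:E)%E.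
    apply: delayed_le => // x xt; first exact: cdf_on_ge0.
      by rewrite G0//; case/andP: (sub _ xt).
    by have := leM _ (sub _ xt); rewrite ler_norml => /andP[_]; lra.
  have h2 : (delayed mu (open_cdf c) t <= delayed mu F t + M%:E)%E.
    apply: delayed_le => // x xt; last first.
    - by have := leM _ (sub _ xt); rewrite ler_norml => /andP[+ _]; lra.
    - exact: cdf_on_ge0.
    - by rewrite G0//; case/andP: (sub _ xt).
  move: h1 h2; rewrite delayed_open_cdf// -served_prob_delayed -!EFinD !lee_fin.
  set S := served_prob _ _ _; set SG := _ / _ * _ => h1 h2.
  (* The candidate solves the same equation, so subtraction leaves only the difference of the served
     terms. *)
  have eqG : beta * open_cdf c t - alpha / mu * SG = c.
    rewrite /SG /open_cdf /kappa /decay_rate -/beta.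
    set e := expR _.
    have -> : beta * (c / gamma - c / gamma * (alpha / (mu * beta)) * e) =
       c / gamma * (beta - alpha / mu * e) by field; rewrite !gt_eqF.
    rewrite /beta /total_rate; field; rewrite !gt_eqF//.
  have : F t - open_cdf c t = alpha / (mu * beta) * (S - SG).
    have h : beta * (F t - open_cdf c t) = alpha / mu * (S - SG).
      by have := eqF t; rewrite t0 tT => /(_ isT); rewrite -/S; lra.
    apply: (mulfI (lt0r_neq0 beta_gt0)); rewrite h; field; rewrite !gt_eqF//.
  move=> ->; rewrite normrM gtr0_norm// ler_pM2l// ler_norml.
  by apply/andP; split; lra.
have M_le0 : M <= 0.
  have : M <= alpha / (mu * beta) * M.
    apply: sup_le_ub; first by case: hsE.
    by move=> _ [t /= + <-]; rewrite in_itv/=; exact: contr.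
  move=> h; have : M * (1 - alpha / (mu * beta)) <= 0 by lra.
  by rewrite pmulr_lle0// subr_gt0.
move=> t /leM /le_trans /(_ M_le0); rewrite normr_le0 subr_eq0 => /eqP//.
Qed.

End equilibrium.

(** * Necessary conditions: no atoms, constant cost, the cdf on each time range *)

Section equilibrium_to_cdf.
Local Open Scope classical_set_scope.
Context {R : realType} (alpha gamma mu T : R).
Hypotheses (alpha_gt0 : 0 < alpha) (gamma_gt0 : 0 < gamma) (mu_gt0 : 0 < mu)
  (T_gt0 : 0 < T).
Implicit Types (c s t u : R).

Let beta := total_rate alpha gamma mu.

Let alphamu_gt0 : 0 < alpha / mu. Proof. exact: divr_gt0. Qed.

Let beta_gt0 : 0 < beta. Proof. exact: total_rate_gt0. Qed.

Variables (F : cdf_on R) (c : R).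
Hypothesis eqF : symmetric_equilibrium alpha gamma T mu_gt0 F c.

Let cost t := alpha * wait_before_opening t + beta * ((cdf_left F t + F t) / 2)
   - alpha / mu * served_prob mu_gt0 F t.

Let FT : F T = 1. Proof. by case: eqF. Qed.

Let cost_support t : cdf_support F t -> cost t = c.
Proof. by case: eqF => _ _ h _ /h; rewrite expected_costE => -[]. Qed.

Let cost_ge t : t <= T -> c <= cost t.
Proof. by case: eqF => _ _ _ h /h; rewrite expected_costE lee_fin. Qed.

(** Arriving earlier than an atom of size [D] saves at least beta D / 2 in congestion, while the
    extra wait and the lost served probability cost at most alpha (t - s) each. *)
Lemma equilibrium_no_atom t : cdf_left F t = F t.
Proof.
(* The final arithmetic over plain variables; [d] stands for [beta * D]. *)
have contra (a a' b b' q q' d : R) : 0 < d -> a' <= a + d / 8 -> b' <= b ->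
  q <= q' + d / 8 -> a + (b + d / 2) - q <= a' + b' - q' -> False by lra.
apply/eqP; rewrite eq_le cdf_left_le/= leNgt; apply/negP => atom.
have tT : t <= T.
  rewrite leNgt; apply/negP => Tt; move: atom; rewrite ltNge => /negP; apply.
  by rewrite (le_trans (cdf_on_le1 _ _))// -FT cdf_left_ge.
have : cdf_support F t.
  apply/cdf_supportP => e e0.
  apply: (@le_lt_trans _ _ (cdf_left F t)); first by rewrite cdf_left_ge//; lra.
  by apply: (lt_le_trans atom); apply: cdf_on_homo; lra.
move=> /cost_support ct.
pose D := F t - cdf_left F t.
have D0 : 0 < D by rewrite subr_gt0.
pose s := t - beta * D / (8 * alpha).
have st : s < t by rewrite ltrBlDr ltrDl divr_gt0// mulr_gt0.
have := @cost_ge s (ltW (lt_le_trans st tT)); rewrite -ct /cost.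
have /andP[_ w] := wait_before_opening_le (ltW st).
have A : beta * ((cdf_left F s + F s) / 2) <= beta * cdf_left F t.
  rewrite ler_pM2l//; have := cdf_left_ge F st; have := cdf_left_le F s; lra.
have Q : alpha / mu * served_prob mu_gt0 F t <=
    alpha / mu * served_prob mu_gt0 F s + alpha * (t - s).
  have -> : alpha * (t - s) = alpha / mu * (mu * (t - s)).
    by field; rewrite gt_eqF.
  by rewrite -mulrDr ler_pM2l// served_prob_lipschitz// ltW.
have W : alpha * wait_before_opening s <=
    alpha * wait_before_opening t + alpha * (t - s).
  by rewrite -mulrDr ler_pM2l.
have ts : alpha * (t - s) = beta * D / 8.
  by rewrite /s; field; rewrite gt_eqF.
have bD : 0 < beta * D by rewrite mulr_gt0.
rewrite ts in W Q.
have -> : beta * ((cdf_left F t + F t) / 2) =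
  beta * cdf_left F t + beta * D / 2 by rewrite /D; field.
exact: contra bD W A Q.
Qed.

Let costE t : cost t = alpha * wait_before_opening t + beta * F t
   - alpha / mu * served_prob mu_gt0 F t.
Proof. by rewrite /cost equilibrium_no_atom; congr (_ + _ - _); field. Qed.

(* The leftmost point [s] with [F s = F t] belongs to the support, and between
   [s] and [t] the cost does not increase. *)
Lemma equilibrium_cost_const t : t <= T -> 0 < F t -> cost t = c.
Proof.
move=> tT Ft0; apply/eqP; rewrite eq_le cost_ge// andbT.
pose E : set R := [set u | F t <= F u].
have [u0 Fu0] : exists u0, F u0 < F t.
  have := @cvgr_lt _ _ _ _ _ _ (cumulativeNy F) _ Ft0.
  (* The limit at -oo controls the values strictly below [u], whence [u - 1]. *)
  by move=> [u [_ h]]; exists (u - 1); apply: h; lra.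
have hE : has_inf E.
  split; first by exists t; rewrite /E /=.
  exists u0 => u; rewrite /E /= => h; rewrite leNgt; apply/negP => uu0.
  by move: (lt_le_trans Fu0 h); rewrite ltNge cdf_on_homo// ltW.
pose s := inf E.
have st : s <= t by apply: ge_inf; [case: hE|rewrite /E /=].
have Fst : F s = F t.
  (* Right-continuity makes the infimum attained: [E] has points just above [s]. *)
  apply/eqP; rewrite eq_le cdf_on_homo//=; apply/ler_addgt0Pr => e e0.
  have [d Fd] := nondecreasing_right_continuousP s F e0.
  have [u Eu us] := inf_adherent (gt0 d) hE.
  apply: le_trans Fd; apply: le_trans Eu _; apply: cdf_on_homo.
  exact: ltW.
have Fs u : u < s -> F u < F t.
  move=> us; rewrite ltNge; apply/negP => h.
  by move: us; rewrite ltNge ge_inf//; case: hE.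
have cs : cost s = c.
  apply/cost_support/cdf_supportP => e e0.
  apply: (@lt_le_trans _ _ (F t)); first by rewrite Fs//; lra.
  by rewrite -Fst cdf_on_homo//; lra.
rewrite -cs !costE Fst.
have /andP[w _] := wait_before_opening_le st.
have := served_prob_homo mu_gt0 F st; rewrite -(ler_pM2l alphamu_gt0) => Q.
have W : alpha * wait_before_opening t <= alpha * wait_before_opening s.
  by rewrite ler_pM2l.
by rewrite lerB// lerD2r.
Qed.

(** The cost at [T] is at least [gamma]: the served probability is at most 1, so it offsets at most
    alpha / mu of [beta]. *)
Lemma equilibrium_constant_gt0 : 0 < c.
Proof.
have FT0 : 0 < F T by rewrite FT.
rewrite -(equilibrium_cost_const (lexx T) FT0) costE FT.
have : alpha / mu * served_prob mu_gt0 F T <= alpha / mu.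
  by rewrite ler_piMr ?served_prob_le1// ltW.
have : 0 <= alpha * wait_before_opening T.
  by rewrite mulr_ge0 ?(ltW alpha_gt0)// le_max lexx orbT.
rewrite /beta /total_rate mulr1.
by move: gamma_gt0; lra.
Qed.

(** Nobody is served before opening, so the cost is - alpha t + beta F(t). Where F(t) > 0 it equals
    [c]; where F(t) = 0, being at least [c] forces c + alpha t <= 0. *)
Lemma symmetric_equilibrium_before t : t <= 0 ->
  F t = Num.max 0 (c + alpha * t) / beta.
Proof.
move=> t0; have tT : t <= T by apply: le_trans t0 (ltW T_gt0).
have w : wait_before_opening t = - t by rewrite /wait_before_opening max_l// oppr_ge0.
have costt : cost t = - alpha * t + beta * F t.
  by rewrite costE w served_prob_le0//; ring.
have := cdf_on_ge0 F t; rewrite le_eqVlt => /predU1P[Ft0|Ft0].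
  have := cost_ge tT; rewrite costt -Ft0 mulr0 addr0 => h.
  by rewrite max_l ?mul0r//; lra.
have := equilibrium_cost_const tT Ft0; rewrite costt => h.
have cE : c + alpha * t = beta * F t by lra.
by rewrite cE max_r ?mulr_ge0 ?(ltW Ft0) ?(ltW beta_gt0)// mulrAC mulfV ?mul1r ?gt_eqF.
Qed.

(** F(0) = c / beta is positive, so the cost is constant on all of [0, T] and the uniqueness of the
    fixed point applies. *)
Lemma symmetric_equilibrium_open t : 0 <= t <= T -> F t = open_cdf alpha gamma mu c t.
Proof.
move: t; apply: (open_cdf_unique _ _ _ equilibrium_constant_gt0) => // t /andP[t0 tT].
have Ft0 : 0 < F t.
  apply: lt_le_trans (cdf_on_homo F t0).
  rewrite symmetric_equilibrium_before// mulr0 addr0 max_r ?(ltW equilibrium_constant_gt0)//.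
  by rewrite divr_gt0// equilibrium_constant_gt0.
rewrite -(equilibrium_cost_const tT Ft0) costE.
by rewrite /wait_before_opening max_r ?oppr_le0// mulr0 add0r.
Qed.

Lemma symmetric_equilibrium_closed t : T <= t -> F t = 1.
Proof.
by move=> Tt; apply/eqP; rewrite eq_le cdf_on_le1/= -[leLHS]FT cdf_on_homo.
Qed.

End equilibrium_to_cdf.

(** * The explicit cdf *)

Section density.
Local Open Scope classical_set_scope.
Context {R : realType} (alpha gamma mu T : R).
Hypotheses (alpha_gt0 : 0 < alpha) (gamma_gt0 : 0 < gamma) (mu_gt0 : 0 < mu)
  (T_gt0 : 0 < T).
Implicit Types (c s t u : R).

Let beta := total_rate alpha gamma mu.
Let kappa := decay_rate alpha gamma mu.
Let c0 := equilibrium_cost alpha gamma mu T.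
Let G := open_cdf alpha gamma mu c0.

Let beta_gt0 : 0 < beta. Proof. exact: total_rate_gt0. Qed.
Let kappa_gt0 : 0 < kappa. Proof. exact: decay_rate_gt0. Qed.

Let betaE : mu * beta = gamma * mu + alpha. Proof. exact: mul_total_rate. Qed.

Let exponentE t : mu * t / (1 + alpha / (gamma * mu)) = kappa * t.
Proof.
rewrite /kappa /decay_rate /total_rate; field.
by rewrite !gt_eqF ?addr_gt0 ?mulr_gt0.
Qed.

Let oddsE : 1 + gamma * mu / alpha = mu * beta / alpha.
Proof. by rewrite betaE; field; rewrite gt_eqF. Qed.

Let theta_lt1 : alpha / (mu * beta) < 1. Proof. exact: congestion_ratio_lt1. Qed.
Let theta_gt0 : 0 < alpha / (mu * beta). Proof. exact: congestion_ratio_gt0. Qed.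

(** The normalizing factor: [open_cdf] with constant [c] takes the value c / gamma times this at
    [T]. *)
Let ahead_frac := 1 - alpha / (mu * beta) * expR (- kappa * T).

Let ahead_frac_gt0 : 0 < ahead_frac.
Proof.
rewrite subr_gt0; apply: le_lt_trans theta_lt1.
rewrite ler_piMr ?(ltW theta_gt0)//.
by rewrite -expR0 ler_expR mulNr oppr_le0 mulr_ge0// ltW.
Qed.

Lemma equilibrium_costE : c0 = gamma / ahead_frac.
Proof.
rewrite /c0 /equilibrium_cost exponentE oddsE /ahead_frac mulNr.
by congr (_ * (1 - _)^-1); rewrite invf_div mulrC.
Qed.

Lemma equilibrium_cost_gt0 : 0 < c0.
Proof. by rewrite equilibrium_costE divr_gt0. Qed.

(** The value at [T] is linear in [c] with positive slope, so total mass 1 singles out one cost. *)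
Lemma open_cdf_closing c : (open_cdf alpha gamma mu c T = 1) <-> (c = c0).
Proof.
have -> : open_cdf alpha gamma mu c T = c / gamma * ahead_frac.
  by rewrite /open_cdf /ahead_frac -/beta -/kappa; ring.
have ag : ahead_frac / gamma != 0.
  by rewrite gt_eqF// divr_gt0.
rewrite equilibrium_costE; split => [h|->].
  apply: (mulIf ag); transitivity (c / gamma * ahead_frac); first by ring.
  by rewrite h; field; rewrite !gt_eqF.
by field; rewrite !gt_eqF.
Qed.

(* The two summands are the masses of (-oo, t] before and after opening; the
   clamping makes the formula valid, and visibly continuous, on the whole line. *)
Definition equilibrium_cdf t :=
  Num.max 0 (c0 + alpha * Num.min t 0) / beta
  + (G (Num.max 0 (Num.min t T)) - G 0).

(** The derivative of [G]. *)
Let density_open u := kappa * (c0 / gamma * (alpha / (mu * beta))) * expR (- kappa * u).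

Let density_early := alpha / beta.

(** The zero of c0 + alpha t, which is the left end of the support and not the time 0 at which
    service starts. *)
Let opening := - (c0 / alpha).

Lemma equilibrium_densityE t :
  (equilibrium_density alpha gamma mu T t)%:E =
  (((cst density_early%:E) \_ `[opening, 0%R[) t
   + ((fun u => (density_open u)%:E) \_ `[0%R, T]) t)%E.
Proof.
rewrite /equilibrium_density !patchE !mem_setE !in_itv/=.
have -> : - (gamma / alpha) * (1 - expR (- (mu * T / (1 + alpha / (gamma * mu)))) /
    (1 + gamma * mu / alpha))^-1 = opening.
  by rewrite /opening /c0 /equilibrium_cost; ring.
rewrite -[alpha / (gamma + _)]/density_early.
have [t0|t0] := ltP t 0; last first.
  rewrite andbF add0e; case: ifPn => _; last by [].
  congr (_%:E); rewrite /density_open !exponentE oddsE equilibrium_costE.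
  rewrite [- kappa * t]mulNr; congr (_ * _).
  have -> : 1 + alpha / (gamma * mu) = beta / gamma.
    by rewrite /beta /total_rate; field; rewrite !gt_eqF.
  (* Up to the factor [alpha], the left side is the second factor in the denominator of the
     density. *)
  have : mu * beta - alpha * expR (- kappa * T) = mu * beta * ahead_frac.
    by rewrite /ahead_frac; field; rewrite !gt_eqF.
  rewrite /ahead_frac [- kappa * T]mulNr; set E := expR _ => h.
  rewrite /kappa /decay_rate -/beta.
  field; rewrite !gt_eqF//= h.
  move: ahead_frac_gt0; rewrite /ahead_frac [- kappa * T]mulNr => h1.
  by rewrite mulr_gt0// mulr_gt0.
by rewrite andbT andFb [X in (_ + X)%E](_ : _ = 0%E)// adde0; case: ifPn.
Qed.

(** The two pieces are integrated separately: the early one is a constant times a length, the open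
    one has antiderivative [G]. *)
Lemma equilibrium_density_integral t :
  (\int[lebesgue_measure]_(x in `]-oo, t])
     (equilibrium_density alpha gamma mu T x)%:E)%E = (equilibrium_cdf t)%:E.
Proof.
have early_ge0 : 0 <= density_early by rewrite divr_ge0// ltW.
have open_ge0 u : 0 <= density_open u.
  rewrite mulr_ge0 ?expR_ge0// mulr_ge0 ?(ltW kappa_gt0)//.
  by rewrite mulr_ge0 ?(ltW theta_gt0)// divr_ge0 ?ltW// equilibrium_cost_gt0.
have mopen : measurable_fun setT (fun u : R => (density_open u)%:E).
  apply/measurable_EFinP; apply: measurable_funM => //.
  by apply: measurableT_comp => //.
under eq_integral do rewrite equilibrium_densityE.
rewrite ge0_integralD//; first last.
- by apply/measurable_restrict => //; exact: measurable_funTS.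
- by move=> x _; apply: erestrict_ge0 => u _; rewrite lee_fin.
- by apply/measurable_restrict.
- by move=> x _; apply: erestrict_ge0 => u _; rewrite lee_fin.
rewrite -!integral_mkcondr /equilibrium_cdf EFinD; congr (_ + _)%E.
  rewrite integral_cst//; last exact: measurableI.
  have [t0|t0] := ltP t 0.
    rewrite (_ : _ `&` _ = `[opening, t]); last first.
      apply/seteqP; split => x /=; rewrite !in_itv/=.
        by move=> [xt /andP[ox _]]; rewrite ox.
      by move=> /andP[-> xt]; split=> //; exact: le_lt_trans t0.
    rewrite /= lebesgue_measure_itv/= lte_fin.
    have -> : c0 + alpha * t = alpha * (t - opening).
      by rewrite /opening; field; rewrite gt_eqF.
    (* The clamp at 0 in [equilibrium_cdf] accounts for [t] up to [opening], where the interval is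
       null. *)
    have [ot|ot] := ltP opening t.
      rewrite max_r; last by rewrite mulr_ge0// ?(ltW alpha_gt0)// subr_ge0 ltW.
      by rewrite -EFinB -EFinM; congr (_%:E); rewrite /density_early; ring.
    rewrite max_l ?mul0r ?mule0//.
    by rewrite mulr_ge0_le0 ?(ltW alpha_gt0)// subr_le0.
  rewrite (_ : _ `&` _ = `[opening, 0%R[); last first.
    apply/seteqP; split => x /=; rewrite !in_itv/=; first by move=> [].
    by move=> /andP[-> x0]; split => //; exact: ltW (lt_le_trans x0 t0).
  have o0 : opening < 0 by rewrite oppr_lt0 divr_gt0// equilibrium_cost_gt0.
  rewrite mulr0 addr0 max_r ?(ltW equilibrium_cost_gt0)//.
  rewrite /= lebesgue_measure_itv/= lte_fin o0 -EFinB -EFinM; congr (_%:E).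
  by rewrite /density_early /opening; field; rewrite !gt_eqF.
have [t0|t0] := ltP t 0.
  rewrite (_ : _ `&` _ = set0); last first.
    apply/seteqP; split => x //=; rewrite !in_itv/=.
    by move=> [xt /andP[x0 _]]; move: (le_lt_trans xt t0); rewrite ltNge x0.
  rewrite integral_set0 max_l ?subrr//.
  by rewrite ge_min (ltW t0).
rewrite (_ : _ `&` _ = `[0%R, Num.min t T]); last first.
  apply/seteqP; split => x /=; rewrite !in_itv/= le_min.
    by move=> [-> /andP[-> ->]].
  by move=> /and3P[-> -> ->].
have tT0 : 0 <= Num.min t T by rewrite le_min t0 ltW.
rewrite max_r//.
have dG u : is_derive u 1 G (density_open u).
  rewrite /G open_cdf_affineE.
  have := @is_deriveD _ _ _ _ _ u 1 _ _ (is_derive_cst (c0 / gamma) u 1)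
    (is_derive_expR_affine (- (c0 / gamma * (alpha / (mu * beta)))) (- kappa) 0 u).
  by move=> k; apply: (is_derive_eq k); rewrite /density_open addr0 add0r; ring.
rewrite (integral_derive tT0 dG)//.
have -> : density_open =
    (fun u => kappa * (c0 / gamma * (alpha / (mu * beta))) * expR (- kappa * u + 0)).
  by apply/funext => u; rewrite addr0.
exact: continuous_expR_affine.
Qed.

End density.

(** * Shape and continuity of the explicit cdf *)

Section equilibrium_cdf.
Local Open Scope classical_set_scope.
Context {R : realType} (alpha gamma mu T : R).
Hypotheses (alpha_gt0 : 0 < alpha) (gamma_gt0 : 0 < gamma) (mu_gt0 : 0 < mu)
  (T_gt0 : 0 < T).
Implicit Types (s t u : R).

Let beta := total_rate alpha gamma mu.
Let kappa := decay_rate alpha gamma mu.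
Let c0 := equilibrium_cost alpha gamma mu T.
Let G := open_cdf alpha gamma mu c0.
Let H := equilibrium_cdf alpha gamma mu T.
Let opening := - (c0 / alpha).

Let beta_gt0 : 0 < beta. Proof. exact: total_rate_gt0. Qed.
Let kappa_gt0 : 0 < kappa. Proof. exact: decay_rate_gt0. Qed.
Let c0_gt0 : 0 < c0. Proof. exact: equilibrium_cost_gt0. Qed.

Let opening_lt0 : opening < 0. Proof. by rewrite oppr_lt0 divr_gt0. Qed.

Let costE t : c0 + alpha * t = alpha * (t - opening).
Proof. by rewrite /opening; field; rewrite gt_eqF. Qed.

Lemma equilibrium_cdf_before t : t <= 0 -> H t = Num.max 0 (c0 + alpha * t) / beta.
Proof.
move=> t0; have tT : t <= T by exact: le_trans t0 (ltW T_gt0).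
by rewrite /H /equilibrium_cdf (min_l t0) (min_l tT) (max_l t0) subrr addr0.
Qed.

(** The mass c0 / beta accumulated by time 0 is exactly [G 0], so it cancels. *)
Lemma equilibrium_cdf_open t : 0 <= t <= T -> H t = G t.
Proof.
move=> /andP[t0 tT].
rewrite /H /equilibrium_cdf (min_r t0) (min_l tT) (max_r t0) mulr0 addr0.
by rewrite max_r ?(ltW c0_gt0)// (open_cdf0 alpha_gt0)// addrC subrK.
Qed.

Lemma equilibrium_cdf_closed t : T <= t -> H t = 1.
Proof.
move=> Tt.
have <- : H T = 1.
  rewrite equilibrium_cdf_open; last by rewrite lexx ltW.
  exact: (open_cdf_closing alpha_gt0 gamma_gt0 mu_gt0 T_gt0 c0).2.
have t0 : 0 <= t by exact: le_trans (ltW T_gt0) Tt.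
by rewrite /H /equilibrium_cdf (min_r Tt) minxx (min_r t0) (min_r (ltW T_gt0)).
Qed.

Lemma equilibrium_cdf_homo : {homo H : s t / s <= t}.
Proof.
move=> s t st; rewrite /H /equilibrium_cdf lerD//.
  rewrite ler_pM2r ?invr_gt0//.
  rewrite ge_max !le_max lexx/=; apply/orP; right.
  rewrite lerD2l ler_pM2l// le_min !ge_min lexx st orbT//.
rewrite lerB//; apply: open_cdf_homo => //.
rewrite ge_max !le_max lexx/=; apply/orP; right.
by rewrite le_min !ge_min lexx st orbT.
Qed.

(** Strictness on the whole interval, across 0 included, is what makes the support fill it. *)
Lemma equilibrium_cdf_strict s t : opening <= s -> s < t -> t <= T -> H s < H t.
Proof.
have lin u v : opening <= u -> u < v -> v <= 0 -> H u < H v.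
  move=> ou uv v0; rewrite !equilibrium_cdf_before//; last by rewrite (le_trans (ltW uv)).
  rewrite ltr_pM2r ?invr_gt0// !costE.
  rewrite !max_r ?mulr_ge0 ?(ltW alpha_gt0) ?subr_ge0//; last first.
    exact: le_trans ou (ltW uv).
  by rewrite ltr_pM2l// ltrD2r.
move=> os st tT.
have [t0|t0] := leP t 0; first exact: lin.
have [s0|s0] := ltP s 0.
  by apply: lt_le_trans (lin _ _ os s0 (lexx _)) (equilibrium_cdf_homo (ltW t0)).
rewrite !equilibrium_cdf_open ?(ltW t0) ?s0 ?tT//; last exact: le_trans (ltW st) tT.
rewrite ltrD2l ltrN2 ltr_pM2l; last by rewrite mulr_gt0// divr_gt0// mulr_gt0.
by rewrite ltr_expR !mulNr ltrN2 ltr_pM2l.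
Qed.

Lemma equilibrium_cdf_opening t : t <= opening -> H t = 0.
Proof.
move=> ot; rewrite equilibrium_cdf_before; last exact: le_trans ot (ltW opening_lt0).
rewrite costE max_l ?mul0r// mulr_ge0_le0 ?(ltW alpha_gt0)//.
by rewrite subr_le0.
Qed.

Lemma equilibrium_cdf_continuous : continuous H.
Proof.
move=> t; rewrite /H /equilibrium_cdf.
have cid : {for t, continuous (id : R -> R)} by [].
have cc (a : R) : {for t, continuous (fun=> a : R)} by exact: cvg_cst.
apply: cvgD.
  apply: cvgM; last exact: cvg_cst.
  apply: (@continuous_max _ _ (fun=> 0) (fun t => c0 + alpha * Num.min t 0)) => //.
  apply: cvgD; first exact: cvg_cst.
  apply: cvgM; first exact: cvg_cst.
  exact: (@continuous_min _ _ id (fun=> 0)).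
apply: cvgB; last exact: cvg_cst.
apply: (@continuous_comp _ _ _ (fun t => Num.max 0 (Num.min t T)) G).
  apply: (@continuous_max _ _ (fun=> 0) (fun t => Num.min t T)) => //.
  exact: (@continuous_min _ _ id (fun=> T)).
exact: open_cdf_continuous.
Qed.

Let H_right_continuous : right_continuous H.
Proof. exact/right_continuousW/equilibrium_cdf_continuous. Qed.

Let H_Ny : H @ -oo --> (0 : R).
Proof.
apply: cvg_near_cst; exists opening; split; first exact: num_real.
by move=> t /ltW /equilibrium_cdf_opening ->.
Qed.

Let H_y : H @ +oo --> (1 : R).
Proof.
apply: cvg_near_cst; exists T; split; first exact: num_real.
by move=> t /ltW /equilibrium_cdf_closed ->.
Qed.

HB.instance Definition _ :=
  isCumulative.Build R _ R H equilibrium_cdf_homo H_right_continuous.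

HB.instance Definition _ := isCumulativeBounded.Build R 0 1 H H_Ny H_y.

(** Exports the cdf structure, whose construction depends on the positivity hypotheses. *)
Lemma equilibrium_cdf_exists : exists F : cdf_on R, F =1 H.
Proof. by exists H. Qed.

End equilibrium_cdf.

(** * The explicit cdf is an equilibrium *)

Section cdf_to_equilibrium.
Local Open Scope classical_set_scope.
Context {R : realType} (alpha gamma mu T : R).
Hypotheses (alpha_gt0 : 0 < alpha) (gamma_gt0 : 0 < gamma) (mu_gt0 : 0 < mu)
  (T_gt0 : 0 < T).
Implicit Types (s t u : R).

Let beta := total_rate alpha gamma mu.
Local Notation c0 := (equilibrium_cost alpha gamma mu T).
Local Notation H := (equilibrium_cdf alpha gamma mu T).
Let opening := - (c0 / alpha).

Let beta_gt0 : 0 < beta. Proof. exact: total_rate_gt0. Qed.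
Let c0_gt0 : 0 < c0. Proof. exact: equilibrium_cost_gt0. Qed.
Let opening_lt0 : opening < 0. Proof. by rewrite oppr_lt0 divr_gt0. Qed.

Variable F : cdf_on R.
Hypothesis FH : F =1 H.

(** For x < t, F(x) is at most the left limit; continuity lets x tend to t. *)
Lemma cdf_left_equilibrium t : cdf_left F t = F t.
Proof.
apply/eqP; rewrite eq_le cdf_left_le/=.
have cF : F x @[x --> t^'-] --> F t.
  rewrite (funext FH : (F : R -> R) = H).
  by apply: cvg_at_left_filter; exact: equilibrium_cdf_continuous.
apply: (cvgr_to_le cF); near=> x; apply: cdf_left_ge.
by near: x; exact: nbhs_left_lt.
Unshelve. all: by end_near. Qed.

Lemma support_equilibrium : cdf_support F = `[opening, T].
Proof.
apply/seteqP; split => t; rewrite /= in_itv/=.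
  move=> /cdf_supportP h; apply/andP; split; rewrite leNgt; apply/negP => lt.
    (* With the distance to the interval as radius, [F] takes equal values at both ends of the
       neighbourhood. *)
    have := h (opening - t); rewrite subr_gt0 => /(_ lt).
    rewrite !FH !equilibrium_cdf_opening ?ltxx//; rewrite -/opening; lra.
  have := h (t - T); rewrite subr_gt0 => /(_ lt).
  by rewrite !FH !equilibrium_cdf_closed ?ltxx//; lra.
move=> /andP[ot tT]; apply/cdf_supportP => e e0; rewrite !FH.
(* The neighbourhood is clamped to the interval, where strict monotonicity holds. *)
apply: (@le_lt_trans _ _ (H (Num.max opening (t - e)))).
  by apply: equilibrium_cdf_homo => //; rewrite le_max lexx orbT.
apply: (@lt_le_trans _ _ (H (Num.min T (t + e)))).
  apply: equilibrium_cdf_strict => //.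
  - by rewrite le_max lexx.
  - rewrite gt_max !lt_min.
    have h : opening < T by exact: lt_trans opening_lt0 T_gt0.
    by rewrite h/=; apply/andP; split; [|apply/andP; split]; lra.
  - by rewrite ge_min lexx.
by apply: equilibrium_cdf_homo => //; rewrite ge_min lexx orbT.
Qed.

Lemma regular_support_equilibrium : regular_support F.
Proof.
(* One pair suffices: if the two intervals are disjoint, its endpoints are reversed and it denotes
   the empty set. *)
move=> a b; exists [:: (Num.max opening a, Num.min T b)].
rewrite support_equilibrium; apply/seteqP; split => x /=.
  rewrite !in_itv/= => -[/andP[ox xT] /andP[ax xb]].
  exists (Num.max opening a, Num.min T b); first by rewrite /= inE.
  by rewrite /= in_itv/= ge_max le_min ox ax xT xb.
move=> [p]; rewrite /= inE => /eqP ->.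
by rewrite !in_itv/= ge_max le_min => /andP[/andP[-> ->] /andP[-> ->]].
Qed.

Let cost t := alpha * wait_before_opening t + beta * F t
   - alpha / mu * served_prob mu_gt0 F t.

Let expected_cost_equilibrium t :
  expected_cost alpha gamma mu_gt0 F t = (cost t)%:E.
Proof.
rewrite expected_costE cdf_left_equilibrium; congr (_%:E).
by congr (_ + _ * _ - _); field.
Qed.

(** Adding the waiting cost to the clamped cdf term gives a maximum, from which both the equality on
    the support and the lower bound before it are read off. *)
Let cost_before t : t <= 0 -> cost t = Num.max (- alpha * t) c0.
Proof.
move=> t0; rewrite /cost served_prob_le0// mulr0 subr0 FH equilibrium_cdf_before//.
rewrite /wait_before_opening max_l ?oppr_ge0//.
rewrite [beta * _]mulrC -mulrA mulVf ?mulr1 ?gt_eqF//.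
by rewrite addr_maxr addr0; congr Num.max; ring.
Qed.

(** The served probability at [t] involves only values of [F] on [0, t], where it is [open_cdf], so
    its closed form is available. *)
Let cost_open t : 0 <= t <= T -> cost t = c0.
Proof.
move=> /andP[t0 tT].
have served : served_prob mu_gt0 F t =
    c0 / gamma * (1 - expR (- decay_rate alpha gamma mu * t)).
  apply: EFin_inj; rewrite served_prob_delayed -delayed_open_cdf//.
  apply: eq_integral => x /set_mem; rewrite /= in_itv/= => /andP[x0 xt].
  rewrite FH equilibrium_cdf_open//; lra.
rewrite /cost served FH equilibrium_cdf_open ?t0//.
rewrite /wait_before_opening max_r ?oppr_le0// mulr0 add0r.
rewrite /open_cdf -/beta; set e := expR _.
have -> : beta * (c0 / gamma - c0 / gamma * (alpha / (mu * beta)) * e) =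
   c0 / gamma * (beta - alpha / mu * e) by field; rewrite !gt_eqF.
by rewrite /beta /total_rate; field; rewrite !gt_eqF.
Qed.

Lemma equilibrium_of_cdf : symmetric_equilibrium alpha gamma T mu_gt0 F c0.
Proof.
split.
- by rewrite FH equilibrium_cdf_closed.
- exact: regular_support_equilibrium.
- move=> t; rewrite support_equilibrium expected_cost_equilibrium /= in_itv/=.
  move=> /andP[ot tT]; congr (_%:E).
  have [t0|t0] := leP t 0; last by rewrite cost_open// (ltW t0).
  rewrite cost_before// max_r//.
  have : 0 <= alpha * (t - opening) by rewrite mulr_ge0 ?subr_ge0// ltW.
  have -> : alpha * (t - opening) = alpha * t + c0.
    by rewrite /opening; field; rewrite gt_eqF.
  lra.
- move=> t tT; rewrite expected_cost_equilibrium lee_fin.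
  have [t0|t0] := leP t 0; last by rewrite cost_open// (ltW t0).
  by rewrite cost_before// le_max lexx orbT.
Qed.

End cdf_to_equilibrium.

(** * From density to cdf, and the characterization of equilibria *)

Lemma has_densityP (R : realType) (alpha gamma mu T : R) (F : cdf_on R) :
  0 < alpha -> 0 < gamma -> 0 < mu -> 0 < T ->
  has_density F (equilibrium_density alpha gamma mu T) <->
  F =1 equilibrium_cdf alpha gamma mu T.
Proof.
move=> a0 g0 m0 T0; split=> h t; have := h t.
  by rewrite equilibrium_density_integral// => -[->].
by move=> ->; rewrite equilibrium_density_integral.
Qed.

Unset Implicit Arguments.

Theorem theorem2p3 (R : realType) (alpha gamma mu T : R)
    (alpha_gt0 : 0 < alpha) (gamma_gt0 : 0 < gamma) (mu_gt0 : 0 < mu)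
    (T_gt0 : 0 < T) :
  (exists F : cdf_on R,
     has_density F (equilibrium_density alpha gamma mu T)) /\
  (forall (F : cdf_on R) (c_e : R),
     symmetric_equilibrium alpha gamma T mu_gt0 F c_e <->
     has_density F (equilibrium_density alpha gamma mu T) /\
     c_e = equilibrium_cost alpha gamma mu T).
Proof.
split.
  have [F FH] := equilibrium_cdf_exists alpha_gt0 gamma_gt0 mu_gt0 T_gt0.
  by exists F; apply/has_densityP.
move=> F c; split=> [eqF|[/has_densityP FH ->]]; last first.
  by apply: equilibrium_of_cdf => //; exact: FH.
(* The open-phase formula at [T] together with F(T) = 1 determines the cost. *)
have cE : c = equilibrium_cost alpha gamma mu T.
  apply/(open_cdf_closing alpha_gt0 gamma_gt0 mu_gt0 T_gt0).
  rewrite -(symmetric_equilibrium_open alpha_gt0 gamma_gt0 T_gt0 eqF).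
    exact: (symmetric_equilibrium_closed eqF).
  by rewrite lexx ltW.
split=> //; apply/has_densityP => // t.
have [t0|t0] := leP t 0.
  rewrite (symmetric_equilibrium_before alpha_gt0 gamma_gt0 T_gt0 eqF)//.
  by rewrite equilibrium_cdf_before// cE.
have [tT|Tt] := leP t T; last first.
  by rewrite (symmetric_equilibrium_closed eqF (ltW Tt)) equilibrium_cdf_closed// ltW.
rewrite (symmetric_equilibrium_open alpha_gt0 gamma_gt0 T_gt0 eqF) ?(ltW t0)//.
by rewrite equilibrium_cdf_open ?(ltW t0)// cE.
Qed.
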